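(* In every well-founded chess-like game $G$, $$\mathit{win}_1(G)\neq\emptyset\ \text{ or }\ \mathit{win}_2(G)\neq\emptyset\ \text{ or }\ (\mathit{draw}_1(G)\neq\emptyset\ \text{ and }\ \mathit{draw}_2(G)\neq\emptyset).$$
   Context: A two-player extensive game with perfect information is $G=(T,\mathit{turn},p_1,p_2)$, where $T=(V,E)$ is a (possibly infinite) rooted tree with edges directed away from the root and set of leaves $Z$, $\mathit{turn}:V\setminus Z\to\{1,2\}$ says who moves at each non-leaf node, and $p_i:Z\to\mathbb{R}$ is the payoff function of player $i$. The game is well-founded if $T$ has no infinite paths. The opponent of player $i$ is denoted $-i$. A strategy of player $i$ is a function $s_i$ assigning to each non-leaf node $u$ with $\mathit{turn}(u)=i$ a child of $u$; $S_i$ is the set of these strategies. In a well-founded game, following a joint strategy $s=(s_i,s_{-i})$ from the root leads to a unique leaf, denoted $\mathit{leaf}(s)$. A chess-like game is a two-player well-founded extensive game in which the only possible outcomes (values of $(p_1,p_2)$ at leaves) are $(1,-1)$, $(0,0)$ and $(-1,1)$. $\mathit{win}_i(G)$ is the set of winning strategies of player $i$, i.e. of $s_i\in S_i$ such that $p_i(\mathit{leaf}(s_i,s_{-i}))=1$ for all $s_{-i}\in S_{-i}$. $\mathit{draw}_i(G)$ is the set of strategies guaranteeing player $i$ at least a draw, i.e. of $s_i\in S_i$ such that $p_i(\mathit{leaf}(s_i,s_{-i}))\ge 0$ for all $s_{-i}\in S_{-i}$. *)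

(* Defs.v *)
From mathcomp Require Import all_boot all_order all_algebra.
From mathcomp Require Import boolp classical_sets reals.

Set Implicit Arguments.
Unset Strict Implicit.
Unset Printing Implicit Defensive.

Import Order.TTheory GRing.Theory Num.Theory.

Local Open Scope classical_set_scope.
Local Open Scope ring_scope.

(* The axiom says that every node is reached from the root by exactly one
   directed path. In particular no edge enters the root. *)
Record rooted_tree := RootedTree {
  node :> Type;
  edge : rel node;
  root : node;
  rooted_treeP : forall v : node,
    exists! s : seq node, path edge root s /\ last root s = v
}.

Definition is_leaf (T : rooted_tree) (u : T) : bool :=
  `[< forall v : T, ~~ edge u v >].

(* [is_leaf] is boolean, so the membership proofs carried by the elements of
   these two types are irrelevant. *)
Definition leaf_node (T : rooted_tree) := {z : T | is_leaf z}.
Definition inner_node (T : rooted_tree) := {u : T | ~~ is_leaf u}.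
Definition child (T : rooted_tree) (u : T) := {v : T | edge u v}.

Definition no_infinite_path (T : rooted_tree) : Prop :=
  ~ exists f : nat -> T, forall n : nat, edge (f n) (f n.+1).

Variant player := P1 | P2.

Definition opponent (i : player) : player :=
  match i with P1 => P2 | P2 => P1 end.

Record game (R : realType) := Game {
  game_tree :> rooted_tree;
  turn : inner_node game_tree -> player;
  payoff : player -> leaf_node game_tree -> R
}.

Record wf_game (R : realType) := WfGame {
  wf_game_game :> game R;
  wf_gameP : no_infinite_path wf_game_game
}.

Definition strategy (R : realType) (G : game R) (i : player) : Type :=
  forall u : inner_node G, turn u = i -> child (val u).

Definition joint_strategy (R : realType) (G : game R) : Type :=
  forall i : player, strategy G i.

Definition join_strategies (R : realType) (G : game R) (i : player) :
    strategy G i -> strategy G (opponent i) -> joint_strategy G :=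
  match i with
  | P1 => fun s1 s2 j => match j with P1 => s1 | P2 => s2 end
  | P2 => fun s2 s1 j => match j with P1 => s1 | P2 => s2 end
  end.

Definition move (R : realType) (G : game R) (s : joint_strategy G)
    (u : inner_node G) : child (val u) :=
  s (turn u) u erefl.

Definition next_node (R : realType) (G : game R) (s : joint_strategy G)
    (u : G) : G :=
  if (insub u : option (inner_node G)) is Some w then val (move s w) else u.

Definition play (R : realType) (G : game R) (s : joint_strategy G)
    (n : nat) : G :=
  iter n (next_node s) (root G).

Lemma next_node_edge (R : realType) (G : game R) (s : joint_strategy G) (u : G) :
  ~~ is_leaf u -> edge u (next_node s u).
Proof.
move=> ul; rewrite /next_node; case: insubP => [w _ <-|]; last by rewrite ul.
exact: (valP (move s w)).
Qed.

Lemma play_reaches_leaf (R : realType) (G : wf_game R) (s : joint_strategy G) :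
  exists n : nat, is_leaf (play s n).
Proof.
apply: contrapT => noleaf; apply: (wf_gameP (w := G)).
exists (play s) => n; rewrite /play iterS; apply: next_node_edge.
by apply/negP => nl; apply: noleaf; exists n.
Qed.

(* The play is constant from the first leaf it meets, so the leaf obtained does
   not depend on the index chosen. *)
Definition leaf (R : realType) (G : wf_game R) (s : joint_strategy G) :
    leaf_node G :=
  exist _ (play s (xchoose (play_reaches_leaf s)))
    (xchooseP (play_reaches_leaf s)).

Definition chess_like (R : realType) (G : wf_game R) : Prop :=
  forall z : leaf_node G,
    (payoff P1 z, payoff P2 z) \in [:: (1, -1); (0, 0); (-1, 1)].

Definition win (R : realType) (G : wf_game R) (i : player) :
    set (strategy G i) :=
  [set si | forall so : strategy G (opponent i),
     payoff i (leaf (join_strategies si so)) = 1].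

Definition draw (R : realType) (G : wf_game R) (i : player) :
    set (strategy G i) :=
  [set si | forall so : strategy G (opponent i),
     0 <= payoff i (leaf (join_strategies si so))].

Arguments win {R} G i _.
Arguments draw {R} G i _.

(* Main.v *)
(* For a player [i] and a set [W] of leaves, the attractor of [W] is a set of
   nodes that [i] need not leave and the opponent cannot leave, while the
   complement has the same property with the players exchanged. So [i] can force
   [W], or the opponent can force the complement of [W], according to whether the
   root lies in the attractor. Take for [W] the leaves won by [i], for each [i]:
   preventing the opponent's win is securing a draw. *)
Require Import Defs.
From mathcomp Require Import all_boot all_order all_algebra.
From mathcomp Require Import boolp classical_sets reals.

Set Implicit Arguments.
Unset Strict Implicit.
Unset Printing Implicit Defensive.

Local Open Scope classical_set_scope.

Lemma inner_node_child (T : rooted_tree) (u : inner_node T) :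
  exists v : T, edge (val u) v.
Proof.
apply: contrapT => nochild; move: (valP u); rewrite /is_leaf => /asboolPn; apply.
by move=> v; apply/negP => uv; apply: nochild; exists v.
Qed.

Lemma move_turn (R : realType) (G : game R) (s : joint_strategy G)
  (i : player) (u : inner_node G) (ui : turn u = i) : move s u = s i u ui.
Proof. by case: i / ui. Qed.

Lemma join_strategies_own (R : realType) (G : game R) (i : player)
  (si : strategy G i) (so : strategy G (opponent i)) :
  (join_strategies si so) i = si.
Proof. by case: i si so. Qed.

Lemma turn_opponent (R : realType) (G : game R) (i : player)
  (u : inner_node G) : turn u = i \/ turn u = opponent i.
Proof. by case: i; case: (turn u); [left|right|right|left]. Qed.

Lemma opponentK : involutive opponent.
Proof. by case. Qed.

(** At a leaf [next_node] stays put, so closure under moves at inner nodes suffices. *)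
Lemma play_invariant (R : realType) (G : game R) (s : joint_strategy G)
  (I : set G) :
  I (Defs.root G) -> (forall u : inner_node G, I (val u) -> I (val (move s u))) ->
  forall n, I (play s n).
Proof.
move=> I0 IS; elim=> [//|n IHn]; rewrite /play iterS /next_node.
by case: insubP => [w _ wE|//]; apply: IS; rewrite wE.
Qed.

Definition can_force (R : realType) (G : wf_game R) (i : player)
    (W : set (leaf_node G)) : Prop :=
  exists si : strategy G i, forall so : strategy G (opponent i),
    W (leaf (join_strategies si so)).

(** Player [i] moves to a child in [I] whenever the current node is in [I]. The play then never
    leaves [I], and the leaf that ends it is one of its positions. *)
Lemma can_force_invariant (R : realType) (G : wf_game R) (i : player)
  (I : set G) :
  (forall u : inner_node G, turn u = i -> I (val u) ->
     exists2 v, edge (val u) v & I v) ->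
  (forall u : inner_node G, turn u = opponent i -> I (val u) ->
     forall v, edge (val u) v -> I v) ->
  I (Defs.root G) -> can_force i [set z : leaf_node G | I (val z)].
Proof.
move=> Iown Iopp I0.
have pick (u : inner_node G) : turn u = i ->
    {v : child (val u) | I (val u) -> I (val v)}.
  move=> ui; apply: cid; have [Iu|nIu] := pselect (I (val u)).
    by have [v uv Iv] := Iown u ui Iu; exists (exist _ v uv).
  (* Outside [I] any child will do, but a strategy must choose one there too. *)
  by have [v uv] := inner_node_child u; exists (exist _ v uv).
exists (fun u ui => sval (pick u ui)) => so /=; apply: play_invariant => // u Iu.
have [ui|uo] := turn_opponent i u; last exact: Iopp (valP (move _ u)).
by rewrite (move_turn _ ui) join_strategies_own; case: (pick u ui) => v; apply.
Qed.

(** Since every play ends, staying inside the attractor is enough to reach [W]: no rank decreasing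
    along the play has to be tracked. *)
Inductive attractor (R : realType) (G : game R) (i : player)
    (W : set (leaf_node G)) : G -> Prop :=
| AttractorLeaf (z : leaf_node G) : W z -> attractor i W (val z)
| AttractorOwn (u : inner_node G) (v : G) : turn u = i -> edge (val u) v ->
    attractor i W v -> attractor i W (val u)
| AttractorOpp (u : inner_node G) : turn u = opponent i ->
    (forall v, edge (val u) v -> attractor i W v) ->
    attractor i W (val u).

Lemma attractor_leaf (R : realType) (G : game R) (i : player)
  (W : set (leaf_node G)) (z : leaf_node G) :
  attractor i W (val z) -> W z.
Proof.
move vE : (val z) => v vA; case: vA vE => [z' Wz' /val_inj -> //|u w _ _ _|u _ _] zu.
  by have := valP u; rewrite -zu (valP z).
by have := valP u; rewrite -zu (valP z).
Qed.

Lemma attractor_inner (R : realType) (G : game R) (i : player)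
  (W : set (leaf_node G)) (u : inner_node G) :
  attractor i W (val u) ->
  (turn u = i /\ exists2 v, edge (val u) v & attractor i W v) \/
  (turn u = opponent i /\ forall v, edge (val u) v -> attractor i W v).
Proof.
move vE : (val u) => v vA.
case: vA vE => [z _ uz|u' w ui uw Aw /val_inj ->|u' uo Au /val_inj ->].
- by have := valP u; rewrite uz (valP z).
- by left; split=> //; exists w.
- by right.
Qed.

Lemma determinacy (R : realType) (G : wf_game R) (i : player)
  (W : set (leaf_node G)) :
  can_force i W \/ can_force (opponent i) (~` W).
Proof.
have opp_neq : opponent i <> i by case: i.
have [A0|nA0] := pselect (attractor i W (Defs.root G)).
  left; have [||//|si siP] := @can_force_invariant R G i (attractor i W).
  - by move=> u ui /attractor_inner[[]//|[uo]]; case: opp_neq; rewrite -uo.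
  - by move=> u uo /attractor_inner[[ui]|[]//]; case: opp_neq; rewrite -uo.
  by exists si => so; apply: attractor_leaf (siP so).
right; have [||//|so soP] :=
  @can_force_invariant R G (opponent i) (~` attractor i W).
(* If every child were in the attractor, [u] would be too. *)
- move=> u uo nAu; apply: contrapT => noesc; apply/nAu/AttractorOpp => // v uv.
  by apply: contrapT => nAv; apply: noesc; exists v.
- move=> u; rewrite opponentK => ui nAu v uv Av.
  exact: nAu (AttractorOwn ui uv Av).
by exists so => si Wz; apply: (soP si); apply: AttractorLeaf.
Qed.

(** Each outcome is zero-sum, and a payoff other than 1 is 0 or -1, which leaves the opponent 0 or
    1. *)
Lemma chess_like_opponent_not_win (R : realType) (G : wf_game R) (i : player)
  (z : leaf_node G) :
  chess_like G -> payoff i z <> 1%R -> (0 <= payoff (opponent i) z)%R.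
Proof.
move=> chessG; have:= chessG z; rewrite !inE => /or3P[] /eqP[E1 E2];
  by case: i => /=; rewrite ?E1 ?E2 // ?Num.Theory.ler01.
Qed.

Lemma win_or_opponent_draw (R : realType) (G : wf_game R) (i : player) :
  chess_like G -> win G i !=set0 \/ draw G (opponent i) !=set0.
Proof.
move=> chessG.
have [[si siP]|[so soP]] :=
  determinacy i [set z : leaf_node G | payoff i z = 1%R].
  by left; exists si.
right; exists so => si; exact: chess_like_opponent_not_win (soP si).
Qed.

Unset Implicit Arguments.

Theorem theorem17 (R : realType) (G : wf_game R) :
  chess_like G ->
  win G P1 !=set0 \/ win G P2 !=set0 \/
  (draw G P1 !=set0 /\ draw G P2 !=set0).
Proof.
move=> chessG.
have [win1|draw2] := win_or_opponent_draw P1 chessG; first by left.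
(* If neither player can force a win, each application has given the other player a draw. *)
by have [win2|draw1] := win_or_opponent_draw P2 chessG; right; [left|right].
Qed.
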